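(* Assume $\langle\mathfrak K^{\heartsuit},\mathfrak K\rangle$ is a normed category with the almost amalgamation property and with a Fraïssé sequence $\vec u$. Then for all $\mathfrak K^{\heartsuit}$-objects $a,b$, for all approximate 0-arrows $i\colon a\to\vec u$, $j\colon b\to\vec u$, for every $\mathfrak K$-arrow $f\colon a\to b$ and for every $\varepsilon>0$ such that $\mu(f)<\varepsilon$, there exists an approximate 0-isomorphism $H\colon\vec u\to\vec u$ such that $\rho(j\circ f,\ H\circ i)<\varepsilon$.
   Context: A category $\mathfrak K$ is metric-enriched if each hom-set $\mathfrak K(a,b)$ carries a metric $\rho$ (the value $+\infty$ is allowed) such that $\rho(f_0\circ g,f_1\circ g)\leqslant\rho(f_0,f_1)$ and $\rho(h\circ f_0,h\circ f_1)\leqslant\rho(f_0,f_1)$ whenever the compositions make sense. A normed category is a pair $\langle\mathfrak K^{\heartsuit},\mathfrak K\rangle$ where $\mathfrak K$ is a metric-enriched category and $\mathfrak K^{\heartsuit}$ is a subcategory of $\mathfrak K$ with the same objects. For $f\in\mathfrak K$ put $\mu(f)=\inf\{\rho(j\circ f,i)\colon i,j\in\mathfrak K^{\heartsuit},\ \operatorname{dom}(j)=\operatorname{cod}(f),\ \operatorname{dom}(i)=\operatorname{dom}(f),\ \operatorname{cod}(i)=\operatorname{cod}(j)\}$, with $\inf\emptyset=+\infty$. The normed category has the almost amalgamation property if for all $\mathfrak K^{\heartsuit}$-arrows $f\colon c\to a$, $g\colon c\to b$ and every $\varepsilon>0$ there are $\mathfrak K^{\heartsuit}$-arrows $f'\colon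 a\to w$, $g'\colon b\to w$ with $\rho(f'\circ f,g'\circ g)<\varepsilon$. A sequence $\vec x$ in $\mathfrak K^{\heartsuit}$ is a covariant functor from $\omega$ into $\mathfrak K^{\heartsuit}$, with objects $x_n$ and arrows $x_n^m\colon x_n\to x_m$ ($n\leqslant m$). An approximate arrow $\vec f\colon\vec x\to\vec y$ between sequences in $\mathfrak K^{\heartsuit}$ consists of an increasing map $\varphi\colon\omega\to\omega$ and $\mathfrak K$-arrows $f_n\colon x_n\to y_{\varphi(n)}$ such that for every $\varepsilon>0$ there is $n_0$ with $\rho(f_m\circ x_n^m,\ y_{\varphi(n)}^{\varphi(m)}\circ f_n)<\varepsilon$ whenever $n_0\leqslant n<m$. (Sequences are identified with their cofinal subsequences.) The distance of approximate arrows $\vec f=(f_n,\varphi)$, $\vec g=(g_n,\psi)$ from $\vec x$ to $\vec y$ is $\rho(\vec f,\vec g)=\lim_{n\to\infty}\lim_{m\to\infty}\rho(y_{\varphi(n)}^m\circ f_n,\ y_{\psi(n)}^m\circ g_n)$; approximate arrows at distance $0$ are identified. Sequences in $\mathfrak K^{\heartsuit}$ with approximate arrows form a metric-enriched category. An object $a$ is identified with the constant sequence of identities on $a$, and a $\mathfrak K$-arrow $f\colon a\to b$ with the corresponding constant approximate arrow. For an approximate arrow, $\mu(\vec f)=\lim_{n\to\infty}\mu(f_n)$; it is an approximate 0-arrow if $\mu(\vec f)=0$, and an approximate 0-isomorphism if moreover it is an isomorphism in the category of sequences and approximate arrows. A sequence $\vec u$ in $\mathfrak K^{\heartsuit}$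 is Fraïssé in $\langle\mathfrak K^{\heartsuit},\mathfrak K\rangle$ if: (U) for every object $x$ and every $\varepsilon>0$ there are $n\in\omega$ and a $\mathfrak K$-arrow $f\colon x\to u_n$ with $\mu(f)<\varepsilon$; (A) given $\varepsilon>0$ and a $\mathfrak K^{\heartsuit}$-arrow $f\colon u_n\to y$, there are $m>n$ and a $\mathfrak K$-arrow $g\colon y\to u_m$ with $\mu(g)<\varepsilon$ and $\rho(u_n^m,g\circ f)<\varepsilon$. *)

(* Defs.v *)
From mathcomp Require Import all_boot all_order all_algebra.
From mathcomp Require Import all_classical all_reals all_analysis.

Set Implicit Arguments.
Unset Strict Implicit.
Unset Printing Implicit Defensive.

Import Order.TTheory GRing.Theory Num.Theory.
Import numFieldNormedType.Exports.

Local Open Scope classical_set_scope.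
Local Open Scope ring_scope.
Local Open Scope ereal_scope.

Record metricCategory (R : realType) := MetricCategory {
  object :> Type ;
  arrow : object -> object -> Type ;
  idarr : forall a, arrow a a ;
  hcomp : forall a b c, arrow b c -> arrow a b -> arrow a c ;
  hcompA : forall a b c d (h : arrow c d) (g : arrow b c) (f : arrow a b),
    hcomp h (hcomp g f) = hcomp (hcomp h g) f ;
  hcomp1f : forall a b (f : arrow a b), hcomp (idarr b) f = f ;
  hcompf1 : forall a b (f : arrow a b), hcomp f (idarr a) = f ;
  rho : forall a b, arrow a b -> arrow a b -> \bar R ;
  rho_ge0 : forall a b (f g : arrow a b), 0 <= rho f g ;
  rho_eq0 : forall a b (f g : arrow a b), rho f g = 0 <-> f = g ;
  rhoC : forall a b (f g : arrow a b), rho f g = rho g f ;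
  rho_triangle : forall a b (f g h : arrow a b),
    rho f h <= rho f g + rho g h ;
  rho_compr : forall a b c (f0 f1 : arrow b c) (g : arrow a b),
    rho (hcomp f0 g) (hcomp f1 g) <= rho f0 f1 ;
  rho_compl : forall a b c (h : arrow b c) (f0 f1 : arrow a b),
    rho (hcomp h f0) (hcomp h f1) <= rho f0 f1 }.

Arguments idarr {R m} a.

Notation "g \c f" := (hcomp g f) (at level 40, left associativity).

(* [heart f] says that [f] is an arrow of the subcategory, which has the same
   objects as the ambient category. *)
Record normedCategory (R : realType) := NormedCategory {
  ambient :> metricCategory R ;
  heart : forall a b : ambient, arrow a b -> Prop ;
  heart_idarr : forall a : ambient, heart (idarr a) ;
  heart_comp : forall (a b c : ambient) (g : arrow b c) (f : arrow a b),
    heart g -> heart f -> heart (g \c f) }.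

Arguments heart {R n a b} f.

Section NormedCategoryTheory.
Context {R : realType} (K : normedCategory R).

Definition mu (a b : K) (f : arrow a b) : \bar R :=
  ereal_inf [set r | exists (c : K) (j : arrow b c) (i : arrow a c),
    [/\ heart j, heart i & r = rho (j \c f) i]].

Definition almost_amalgamation : Prop :=
  forall (a b c : K) (f : arrow c a) (g : arrow c b) (eps : R),
    heart f -> heart g -> (0 < eps)%R ->
    exists (w : K) (f' : arrow a w) (g' : arrow b w),
      [/\ heart f', heart g' & rho (f' \c f) (g' \c g) < eps%:E].

Record heartSequence := HeartSequence {
  sobj :> nat -> K ;
  sarr : forall n m, (n <= m)%N -> arrow (sobj n) (sobj m) ;
  sarr_heart : forall n m (nm : (n <= m)%N), heart (sarr nm) ;
  sarr_id : forall n (nn : (n <= n)%N), sarr nn = idarr (sobj n) ;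
  sarr_comp : forall n m k (nm : (n <= m)%N) (mk : (m <= k)%N)
    (nk : (n <= k)%N), sarr nk = sarr mk \c sarr nm }.

(* The index map is strictly increasing, hence cofinal; without cofinality
   approximate arrows would not compose. *)
Record approxArrow (x y : heartSequence) := ApproxArrow {
  aidx : nat -> nat ;
  aidx_homo : forall n m, (n < m)%N -> (aidx n < aidx m)%N ;
  aarr : forall n, arrow (x n) (y (aidx n)) ;
  aarr_approx : forall eps : R, (0 < eps)%R ->
    exists n0, forall n m (nm : (n < m)%N), (n0 <= n)%N ->
      rho (aarr m \c sarr x (ltnW nm))
          (sarr y (ltnW (aidx_homo nm)) \c aarr n) < eps%:E }.

(* In the inner limit [m] has to range over the indices above both [aidx F n]
   and [aidx G n], i.e. over [maxn (aidx F n) (aidx G n) + k]. *)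
Definition approx_dist (x y : heartSequence) (F G : approxArrow x y) : \bar R :=
  limn (fun n => limn (fun k =>
    rho (sarr y (leq_trans (leq_maxl (aidx F n) (aidx G n)) (leq_addr k _))
           \c aarr F n)
        (sarr y (leq_trans (leq_maxr (aidx F n) (aidx G n)) (leq_addr k _))
           \c aarr G n))).

(* Equality of arrows in the category of sequences: approximate arrows at
   distance 0 are identified. *)
Definition approx_eq (x y : heartSequence) (F G : approxArrow x y) : Prop :=
  approx_dist F G = 0.

Lemma rhoxx (a b : K) (f : arrow a b) : rho f f = 0.
Proof. exact/rho_eq0. Qed.

Lemma aidx_ge (x y : heartSequence) (F : approxArrow x y) n :
  (n <= aidx F n)%N.
Proof.
by elim: n => // n IH; apply: leq_ltn_trans IH (aidx_homo F (ltnSn n)).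
Qed.

Lemma approx_id_approx (x : heartSequence) (eps : R) : (0 < eps)%R ->
  exists n0, forall n m (nm : (n < m)%N), (n0 <= n)%N ->
    rho (idarr (x m) \c sarr x (ltnW nm))
        (sarr x (ltnW nm) \c idarr (x n)) < eps%:E.
Proof.
by move=> e0; exists 0%N => n m nm _; rewrite hcomp1f hcompf1 rhoxx lte_fin.
Qed.

Definition approx_id (x : heartSequence) : approxArrow x x :=
  @ApproxArrow x x (fun n => n) (fun _ _ nm => nm) (fun n => idarr (x n))
    (@approx_id_approx x).

Section Composition.
Variables (x y z : heartSequence) (G : approxArrow y z) (F : approxArrow x y).

Definition comp_idx_homo n m (nm : (n < m)%N) :
    (aidx G (aidx F n) < aidx G (aidx F m))%N :=
  aidx_homo G (aidx_homo F nm).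

Lemma approx_comp_approx (eps : R) : (0 < eps)%R ->
  exists n0, forall n m (nm : (n < m)%N), (n0 <= n)%N ->
    rho ((aarr G (aidx F m) \c aarr F m) \c sarr x (ltnW nm))
        (sarr z (ltnW (comp_idx_homo nm)) \c (aarr G (aidx F n) \c aarr F n))
    < eps%:E.
Proof.
move=> e0; have e20 : (0 < eps / 2)%R by rewrite divr_gt0.
have [n1 H1] := aarr_approx F e20; have [n2 H2] := aarr_approx G e20.
exists (maxn n1 n2) => n m nm; rewrite geq_max => /andP[n1n n2n].
have Fn := leq_trans n2n (aidx_ge F n).
rewrite -hcompA.
apply: le_lt_trans (rho_triangle _
  (aarr G (aidx F m) \c (sarr y (ltnW (aidx_homo F nm)) \c aarr F n)) _) _.
rewrite [in ltRHS](splitr eps) EFinD; apply: lteD.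
  exact: le_lt_trans (rho_compl _ _ _) (H1 _ _ nm n1n).
rewrite !hcompA.
exact: le_lt_trans (rho_compr _ _ _) (H2 _ _ (aidx_homo F nm) Fn).
Qed.

Definition approx_comp : approxArrow x z :=
  @ApproxArrow x z (fun n => aidx G (aidx F n)) comp_idx_homo
    (fun n => aarr G (aidx F n) \c aarr F n) approx_comp_approx.

End Composition.

Definition const_seq (a : K) : heartSequence :=
  @HeartSequence (fun _ => a) (fun _ _ _ => idarr a)
    (fun _ _ _ => heart_idarr a) (fun _ _ => erefl)
    (fun _ _ _ _ _ _ => esym (hcomp1f (idarr a))).

Lemma const_arrow_approx (a b : K) (f : arrow a b) (eps : R) : (0 < eps)%R ->
  exists n0, forall n m (nm : (n < m)%N), (n0 <= n)%N ->
    rho (f \c sarr (const_seq a) (ltnW nm))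
        (sarr (const_seq b) (ltnW nm) \c f) < eps%:E.
Proof.
by move=> e0; exists 0%N => n m nm _; rewrite /= hcomp1f hcompf1 rhoxx lte_fin.
Qed.

Definition const_arrow (a b : K) (f : arrow a b) :
    approxArrow (const_seq a) (const_seq b) :=
  @ApproxArrow (const_seq a) (const_seq b) (fun n => n) (fun _ _ nm => nm)
    (fun=> f) (@const_arrow_approx a b f).

Definition approx_mu (x y : heartSequence) (F : approxArrow x y) : \bar R :=
  limn (fun n => mu (aarr F n)).

Definition approx_0arrow (x y : heartSequence) (F : approxArrow x y) : Prop :=
  approx_mu F = 0.

Definition approx_iso (x y : heartSequence) (F : approxArrow x y) : Prop :=
  exists G : approxArrow y x,
    approx_eq (approx_comp G F) (approx_id x) /\
    approx_eq (approx_comp F G) (approx_id y).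

Definition approx_0iso (x y : heartSequence) (F : approxArrow x y) : Prop :=
  approx_0arrow F /\ approx_iso F.

Definition fraisse (u : heartSequence) : Prop :=
  (forall (x : K) (eps : R), (0 < eps)%R ->
     exists (n : nat) (f : arrow x (u n)), mu f < eps%:E) /\
  (forall (eps : R) (n : nat) (y : K) (f : arrow (u n) y),
     (0 < eps)%R -> heart f ->
     exists (m : nat) (nm : (n < m)%N) (g : arrow y (u m)),
       mu g < eps%:E /\ rho (sarr u (ltnW nm)) (g \c f) < eps%:E).

End NormedCategoryTheory.

(* Main.v *)
Require Import Defs.
From mathcomp Require Import all_boot all_order all_algebra.
From mathcomp Require Import all_classical all_reals all_analysis.
From mathcomp Require Import lra zify ring.

Set Implicit Arguments.
Unset Strict Implicit.
Unset Printing Implicit Defensive.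

Import Order.TTheory GRing.Theory Num.Theory.

(** The proof is an approximate back-and-forth argument.

    Pick arrows k and l of the subcategory with rho (k f) l <= r < eps, and an
    error d that is small compared with eps - r.  Far enough in the sequences,
    i_n and j_n satisfy mu < d, hence are d-close to arrows of the subcategory
    after composition with arrows of the subcategory.  Amalgamating these twice
    with l and k, and then returning to u by condition (A), gives an arrow
    z_0 : u_{p_0} -> u_{p_1} with mu z_0 < d which carries i_{n_0} to
    j_{n_0} f up to r + 5d ([first_link]).

    From then on (A) drives the construction: an arrow z_t : u_{p_t} -> u_{p_{t+1}} with
    mu z_t < d_t := d / 2^t can be followed by some
    z_{t+1} : u_{p_{t+1}} -> u_{p_{t+2}} with mu z_{t+1} < d_{t+1} such that
    z_{t+1} z_t is 2 d_t-close to the bonding arrow of u ([turn_back]).  This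
    yields an infinite zigzag ([zigzag_from]).  Since the d_t are summable,
    links of the same parity commute with the bonding arrows up to 4 d_t
    ([zarr_commute]), and links of opposite parity are mutually inverse up to
    4 d_t ([zarr_return]).  So the even links form an approximate arrow H and
    the odd links form its inverse; mu tends to 0 along both, and H i differs
    from j f by what z_0 already costs plus a few d.

    The values approx_mu and approx_dist are limits, so bounding them requires
    that these limits exist.  For every e > 0, the sequences in question never
    drop by more than e past some index, and this forces convergence
    ([almost_nondecreasing_is_cvgn]). *)

(** * Almost nondecreasing sequences *)

Section AlmostMonotone.
Local Open Scope ring_scope.
Local Open Scope ereal_scope.
Context {R : realType}.
Implicit Types s : nat -> \bar R.

Definition almost_nondecreasing s : Prop := forall e : R, (0 < e)%R ->
  exists n0, forall n m, (n0 <= n)%N -> (n < m)%N -> s n <= s m + e%:E.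

(** Each term is at most e above all later ones, hence at most e above the lower
    limit, so the upper limit exceeds the lower limit by at most e. *)
Lemma almost_nondecreasing_is_cvgn s : almost_nondecreasing s -> cvgn s.
Proof.
move=> smono.
have sup_le_inf : limn_esup s <= limn_einf s.
  apply/lee_addgt0Pr => e e0; have [n0 sle] := smono _ e0.
  have le_inf n : (n0 <= n)%N -> s n <= limn_einf s + e%:E.
    move=> n0n; rewrite -leeBlDr//.
    apply: (@le_trans _ _ (einfs s n.+1)).
      apply/ereal_infP => _ [m nm <-].
      by rewrite leeBlDr//; apply: sle.
    rewrite limn_einf_lim (cvg_lim (@ereal_hausdorff R) (@cvg_einfs_sup _ s)).
    by apply: ereal_sup_ubound; exists n.+1.
  rewrite limn_esup_lim; apply: lime_le; first exact: is_cvg_esups.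
  exists n0 => // n /= n0n; apply/ereal_supP => _ [m nm <-].
  exact: le_inf (leq_trans n0n nm).
have inf_eq_sup : limn_einf s = limn_esup s.
  by apply/le_anti; rewrite sup_le_inf limn_einf_sup.
apply/cvg_ex; exists (limn_esup s).
apply: (@squeeze_cvge _ _ _ _ (einfs s) _ (esups s)).
- apply: nearW => n; apply/andP; split.
    by apply: ereal_inf_lbound; exists n => /=.
  by apply: ereal_sup_ubound; exists n => /=.
- by rewrite -inf_eq_sup limn_einf_lim; apply: is_cvg_einfs.
- by rewrite limn_esup_lim; apply: is_cvg_esups.
Qed.

Lemma almost_nondecreasing_le_lim s (e : R) : almost_nondecreasing s ->
  (0 < e)%R -> exists n0, forall n, (n0 <= n)%N -> s n <= limn s + e%:E.
Proof.
move=> smono e0; have [n0 sle] := smono _ e0; exists n0 => n n0n.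
rewrite -leeBlDr//; apply: lime_ge; first exact: almost_nondecreasing_is_cvgn.
by exists n.+1 => // m nm; rewrite leeBlDr//; apply: sle.
Qed.

End AlmostMonotone.

(** * The functional mu and the distance of approximate arrows *)

Section MuAndDistance.
Local Open Scope ring_scope.
Local Open Scope ereal_scope.
Context {R : realType} (K : normedCategory R).

Lemma rho_le2 (a b : K) (f g h : arrow a b) (r s : R) :
  rho f g <= r%:E -> rho g h <= s%:E -> rho f h <= (r + s)%:E.
Proof.
by move=> fg gh; apply: le_trans (rho_triangle f g h) _; rewrite EFinD leeD.
Qed.

Lemma rho_perturb (a b : K) (f f' g g' : arrow a b) (r s : R) :
  rho f f' <= r%:E -> rho g' g <= s%:E ->
  rho f g <= rho f' g' + (r + s)%:E.
Proof.
move=> ff' gg'; apply: le_trans (rho_triangle f f' g) _.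
rewrite EFinD addeCA leeD//.
by apply: le_trans (rho_triangle f' g' g) _; rewrite leeD2l.
Qed.

Lemma rho_complW (a b c : K) (h : arrow b c) (f g : arrow a b) (r : \bar R) :
  rho f g <= r -> rho (h \c f) (h \c g) <= r.
Proof. exact: le_trans (rho_compl _ _ _). Qed.

Lemma rho_comprW (a b c : K) (f g : arrow b c) (h : arrow a b) (r : \bar R) :
  rho f g <= r -> rho (f \c h) (g \c h) <= r.
Proof. exact: le_trans (rho_compr _ _ _). Qed.

Lemma mu_ge0 (a b : K) (f : arrow a b) : 0 <= mu f.
Proof. by apply/ereal_infP => _ [c [j [i [_ _ ->]]]]; exact: rho_ge0. Qed.

Lemma mu_le_rho (a b c : K) (f : arrow a b) (j : arrow b c) (i : arrow a c) :
  heart j -> heart i -> mu f <= rho (j \c f) i.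
Proof. by move=> hj hi; apply: ereal_inf_lbound; exists c, j, i. Qed.

Lemma mu_lt (a b : K) (f : arrow a b) (r : \bar R) : mu f < r ->
  exists (c : K) (j : arrow b c) (i : arrow a c),
    [/\ heart j, heart i & rho (j \c f) i < r].
Proof.
by move=> /ereal_inf_lt[_ [c [j [i [hj hi ->]]]] lt_r]; exists c, j, i.
Qed.

Lemma mu_comp_heart (a b c : K) (f : arrow b c) (k : arrow a b) :
  heart k -> mu (f \c k) <= mu f.
Proof.
move=> hk; apply/ereal_infP => _ [d [j [i [hj hi ->]]]].
apply: le_trans (mu_le_rho _ hj (heart_comp hi hk)) _.
by rewrite hcompA; apply: rho_compr.
Qed.

Lemma mu_le_heart_comp (a b c : K) (k : arrow b c) (f : arrow a b) :
  heart k -> mu f <= mu (k \c f).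
Proof.
move=> hk; apply/ereal_infP => _ [d [j [i [hj hi ->]]]].
by rewrite hcompA; apply: mu_le_rho => //; apply: heart_comp.
Qed.

Lemma mu_lip (a b : K) (f g : arrow a b) (e : R) :
  rho f g <= e%:E -> mu f <= mu g + e%:E.
Proof.
move=> fg; rewrite -leeBlDr//; apply/ereal_infP => _ [c [j [i [hj hi ->]]]].
rewrite leeBlDr// addeC; apply: le_trans (mu_le_rho _ hj hi) _.
apply: le_trans (rho_triangle _ (j \c g) _) _.
by rewrite leeD2r//; apply: rho_complW.
Qed.

Lemma sarr_irr (x : heartSequence K) n m (h h' : (n <= m)%N) :
  sarr x h = sarr x h'.
Proof. by rewrite (bool_irrelevance h h'). Qed.

Lemma sarr_compE (x : heartSequence K) n m k (nm : (n <= m)%N)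
    (mk : (m <= k)%N) : sarr x mk \c sarr x nm = sarr x (leq_trans nm mk).
Proof. by rewrite (sarr_comp x nm mk (leq_trans nm mk)). Qed.

(** Composing with a bonding arrow of y does not lower mu, and precomposing with
    one of x does not raise it, so the approximate naturality of F compares
    mu (F_n) with mu (F_m). *)
Lemma mu_aarr_almost_nondecreasing (x y : heartSequence K)
    (F : approxArrow x y) : almost_nondecreasing (fun n => mu (aarr F n)).
Proof.
move=> e e0; have [n0 Fapprox] := aarr_approx F e0.
exists n0 => n m n0n nm.
apply: le_trans (mu_le_heart_comp (aarr F n)
  (sarr_heart y (ltnW (aidx_homo F nm)))) _.
have near_m : rho (sarr y (ltnW (aidx_homo F nm)) \c aarr F n)
    (aarr F m \c sarr x (ltnW nm)) <= e%:E.
  by rewrite rhoC; apply/ltW/Fapprox.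
apply: le_trans (mu_lip near_m) _; rewrite leeD2r//.
by apply/mu_comp_heart/sarr_heart.
Qed.

Lemma approx_0arrow_small (x y : heartSequence K) (F : approxArrow x y)
    (e : R) : approx_0arrow F -> (0 < e)%R ->
  exists n0, forall n, (n0 <= n)%N -> mu (aarr F n) < e%:E.
Proof.
move=> F0 e0; have e20 : (0 < e / 2)%R by rewrite divr_gt0.
have [n0 le_e] := almost_nondecreasing_le_lim
  (mu_aarr_almost_nondecreasing F) e20.
exists n0 => n /le_e; rewrite -/(approx_mu F) F0 add0e => /le_lt_trans; apply.
by rewrite lte_fin ltr_pdivrMr// ltr_pMr// ltr1n.
Qed.

Lemma approx_0arrowP (x y : heartSequence K) (F : approxArrow x y) :
  (forall e : R, (0 < e)%R ->
     exists n0, forall n, (n0 <= n)%N -> mu (aarr F n) <= e%:E) ->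
  approx_0arrow F.
Proof.
move=> small.
have Fcvg := almost_nondecreasing_is_cvgn (mu_aarr_almost_nondecreasing F).
apply/le_anti/andP; split; last first.
  by apply: lime_ge => //; apply: nearW => n; exact: mu_ge0.
apply/lee_addgt0Pr => e e0; rewrite add0e; have [n0 le_e] := small _ e0.
by apply: lime_le => //; exists n0.
Qed.

Section Distance.
Variables (x y : heartSequence K) (F G : approxArrow x y).

Let D n k := rho
  (sarr y (leq_trans (leq_maxl (aidx F n) (aidx G n)) (leq_addr k _))
     \c aarr F n)
  (sarr y (leq_trans (leq_maxr (aidx F n) (aidx G n)) (leq_addr k _))
     \c aarr G n).

Lemma rho_sarr_le n N N' (FN : (aidx F n <= N)%N) (GN : (aidx G n <= N)%N)
    (FN' : (aidx F n <= N')%N) (GN' : (aidx G n <= N')%N) : (N <= N')%N ->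
  rho (sarr y FN' \c aarr F n) (sarr y GN' \c aarr G n) <=
  rho (sarr y FN \c aarr F n) (sarr y GN \c aarr G n).
Proof.
move=> NN'; rewrite (sarr_comp y FN NN' FN') (sarr_comp y GN NN' GN').
by rewrite -!hcompA; apply: rho_compl.
Qed.

Lemma inner_is_cvgn n : cvgn (D n).
Proof.
apply: ereal_nonincreasing_is_cvgn => k k' kk'.
by apply: rho_sarr_le; rewrite leq_add2l.
Qed.

Lemma inner_lim_le n N (FN : (aidx F n <= N)%N) (GN : (aidx G n <= N)%N) :
  limn (D n) <= rho (sarr y FN \c aarr F n) (sarr y GN \c aarr G n).
Proof.
apply: lime_le; first exact: inner_is_cvgn.
exists N => // k /= Nk; apply: rho_sarr_le.
exact: leq_trans Nk (leq_addl _ _).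
Qed.

(** Naturality of F and G, up to e / 2 each, turns a bound at m into a bound at
    every earlier n that is past the threshold. *)
Lemma inner_lim_almost_nondecreasing :
  almost_nondecreasing (fun n => limn (D n)).
Proof.
move=> e e0; have e20 : (0 < e / 2)%R by rewrite divr_gt0.
have [n1 Fapprox] := aarr_approx F e20.
have [n2 Gapprox] := aarr_approx G e20.
exists (maxn n1 n2) => n m; rewrite geq_max => /andP[n1n n2n] nm.
rewrite -leeBlDr//; apply: lime_ge; first exact: inner_is_cvgn.
apply: nearW => k; rewrite leeBlDr//.
pose Fm := leq_trans (leq_maxl (aidx F m) (aidx G m)) (leq_addr k _).
pose Gm := leq_trans (leq_maxr (aidx F m) (aidx G m)) (leq_addr k _).
have Fnm := ltnW (aidx_homo F nm); have Gnm := ltnW (aidx_homo G nm).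
apply: le_trans (inner_lim_le (leq_trans Fnm Fm) (leq_trans Gnm Gm)) _.
rewrite (sarr_comp y Fnm Fm) (sarr_comp y Gnm Gm) -!hcompA.
have Fnear : rho (sarr y Fm \c (sarr y Fnm \c aarr F n))
    (sarr y Fm \c (aarr F m \c sarr x (ltnW nm))) <= (e / 2)%:E.
  apply: rho_complW; rewrite rhoC (sarr_irr _ Fnm (ltnW (aidx_homo F nm))).
  exact/ltW/Fapprox.
have Gnear : rho (sarr y Gm \c (aarr G m \c sarr x (ltnW nm)))
    (sarr y Gm \c (sarr y Gnm \c aarr G n)) <= (e / 2)%:E.
  apply: rho_complW; rewrite (sarr_irr _ Gnm (ltnW (aidx_homo G nm))).
  exact/ltW/Gapprox.
rewrite [e]splitr; apply: le_trans (rho_perturb Fnear Gnear) _.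
by rewrite leeD2r// !hcompA; apply: rho_compr.
Qed.

Lemma approx_dist_ge0 : 0 <= approx_dist F G.
Proof.
apply: lime_ge.
  exact: almost_nondecreasing_is_cvgn inner_lim_almost_nondecreasing.
apply: nearW => n; apply: lime_ge; first exact: inner_is_cvgn.
by apply: nearW => k; exact: rho_ge0.
Qed.

(** The inner limit is an infimum, so a single index N suffices for each n. *)
Lemma approx_dist_le (c : R) (n0 : nat) :
  (forall n, (n0 <= n)%N ->
     exists N (FN : (aidx F n <= N)%N) (GN : (aidx G n <= N)%N),
       rho (sarr y FN \c aarr F n) (sarr y GN \c aarr G n) <= c%:E) ->
  approx_dist F G <= c%:E.
Proof.
move=> le_c; apply: lime_le.
  exact: almost_nondecreasing_is_cvgn inner_lim_almost_nondecreasing.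
exists n0 => // n /le_c[N [FN [GN]]]; apply: le_trans.
exact: inner_lim_le.
Qed.

End Distance.

End MuAndDistance.

(** * Zigzags *)

Section Zigzag.
Local Open Scope ring_scope.
Local Open Scope ereal_scope.
Context {R : realType} (K : normedCategory R) (u : heartSequence K).

(** Two interleaved strands through u.  Only [zidx t < zidx t.+2] holds: (A)
    gives an index above that of the object it starts from, which is two links
    back, and nothing relates it to the index in between. *)
Record zigzag (d : R) := Zigzag {
  zidx : nat -> nat ;
  zarr : forall t, arrow (u (zidx t)) (u (zidx t.+1)) ;
  zidx_lt : forall t, (zidx t < zidx t.+2)%N ;
  zarr_mu : forall t, mu (zarr t) <= (d / 2 ^+ t)%:E ;
  zarr_turn : forall t, rho (zarr t.+1 \c zarr t) (sarr u (ltnW (zidx_lt t)))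
    <= (2 * (d / 2 ^+ t))%:E }.

(** If j h is close to i with i and j in the subcategory, then (A) applied to i
    provides g with g i close to a bonding arrow, and g j is the way back. *)
Lemma turn_back (d d' : R) p q (h : arrow (u p) (u q)) :
  fraisse u -> mu h < d%:E -> (0 < d')%R -> (d' <= d)%R ->
  exists r (k : arrow (u q) (u r)) (pr : (p < r)%N),
    mu k < d'%:E /\ rho (k \c h) (sarr u (ltnW pr)) <= (2 * d)%:E.
Proof.
move=> [_ uA] /mu_lt[c [j [i [hj hi ji]]]] d'0 d'd.
have [r [pr [g [mug ug]]]] := uA _ _ _ _ d'0 hi.
exists r, (g \c j), pr; split.
  by apply: le_lt_trans mug; apply: mu_comp_heart.
rewrite mulrDl mul1r; apply: (@rho_le2 _ _ _ _ _ (g \c i)).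
  by rewrite -hcompA; apply/rho_complW/ltW.
by rewrite rhoC; apply: le_trans (ltW ug) _; rewrite lee_fin.
Qed.

Section Construction.
Variable d : R.

(** A link carries both of its endpoints, so that in the recursion the source of
    a link is convertible to the target of the previous one and the composites
    typecheck without transport. *)
Record link (t : nat) := Link {
  src : nat ;
  tgt : nat ;
  larr : arrow (u src) (u tgt) ;
  larr_mu : mu larr < (d / 2 ^+ t)%:E }.

(** The predicate Q transfers what is known about the first link h; an equality
    between h and [zarr Z 0] would have to be stated across distinct types. *)
Lemma zigzag_from (Q : forall p q, arrow (u p) (u q) -> Prop) p q
    (h : arrow (u p) (u q)) :
  fraisse u -> (0 < d)%R -> mu h < d%:E -> Q p q h ->
  exists Z : zigzag d, Q _ _ (zarr Z 0).
Proof.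
move=> ufraisse d0 muh Qh.
have step t (L : link t) : {r : nat & {k : arrow (u (tgt L)) (u r) |
    exists pr : (src L < r)%N, mu k < (d / 2 ^+ t.+1)%:E /\
      rho (k \c larr L) (sarr u (ltnW pr)) <= (2 * (d / 2 ^+ t))%:E}}.
  have err0 : (0 < d / 2 ^+ t.+1)%R by rewrite divr_gt0// exprn_gt0.
  have errS : (d / 2 ^+ t.+1 <= d / 2 ^+ t)%R.
    rewrite ler_pM2l// lef_pV2 ?posrE ?exprn_gt0//.
    by rewrite ler_eXn2l// ltr1n.
  have [r ex_k] := cid (turn_back ufraisse (larr_mu L) err0 errS).
  by exists r; apply: cid.
have step_mu t (L : link t) :
    mu (projT1 (projT2 (step t L))) < (d / 2 ^+ t.+1)%:E.
  by case: (projT2 (projT2 (step t L))) => ? [].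
have step_lt t (L : link t) : (src L < projT1 (step t L))%N.
  by case: (projT2 (projT2 (step t L))).
have muh0 : mu h < (d / 2 ^+ 0)%:E by rewrite expr0 divr1.
pose chain := nat_rect link (Link muh0)
  (fun t L => @Link t.+1 (tgt L) _ _ (step_mu t L)).
pose p_ t := src (chain t).
pose z_ t : arrow (u (p_ t)) (u (p_ t.+1)) := larr (chain t).
have p_lt t : (p_ t < p_ t.+2)%N by apply: (step_lt t (chain t)).
have z_mu t : mu (z_ t) <= (d / 2 ^+ t)%:E by apply/ltW/larr_mu.
have z_turn t : rho (z_ t.+1 \c z_ t) (sarr u (ltnW (p_lt t)))
    <= (2 * (d / 2 ^+ t))%:E.
  have [pr [_ +]] := projT2 (projT2 (step t (chain t))).
  by rewrite (sarr_irr _ (ltnW pr) (ltnW (p_lt t))).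
by exists (@Zigzag d p_ z_ p_lt z_mu z_turn).
Qed.

End Construction.

Section Theory.
Variables (d : R) (Z : zigzag d).
Local Notation p := (zidx Z).
Local Notation z := (zarr Z).
Hypothesis d_gt0 : (0 < d)%R.

Lemma zidx_le_even t s : (p t <= p (t + s.*2))%N.
Proof.
elim: s => [|s IH]; first by rewrite addn0.
by apply: leq_trans IH (ltnW _); rewrite doubleS !addnS; apply: zidx_lt.
Qed.

Lemma zidx_ge c n : (n <= p (n.*2 + c))%N.
Proof. by elim: n => // n IH; apply: leq_ltn_trans IH (zidx_lt Z _). Qed.

(** Going from z_t to z_{t+2} costs 2 d_t for replacing the bonding arrow by
    z_{t+1} z_t and 2 d_{t+1} = d_t for replacing z_{t+2} z_{t+1} by a bonding
    arrow; from t+2 on the cost is 4 d_{t+2} = d_t by induction. *)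
Lemma zarr_commute s t T (pT : (p t <= p T)%N) (pT1 : (p t.+1 <= p T.+1)%N) :
  T = (t + s.*2)%N ->
  rho (z T \c sarr u pT) (sarr u pT1 \c z t) <= (4 * (d / 2 ^+ t))%:E.
Proof.
elim: s t T pT pT1 => [|s IH] t T pT pT1 eT.
  rewrite addn0 in eT; subst T.
  rewrite !sarr_id hcomp1f hcompf1 rhoxx lee_fin.
  by rewrite mulr_ge0// divr_ge0// ?exprn_ge0// ltW.
have {}eT : T = (t.+2 + s.*2)%N by rewrite eT doubleS !addnS.
have p2T : (p t.+2 <= p T)%N by rewrite eT zidx_le_even.
have p3T : (p t.+3 <= p T.+1)%N by rewrite eT -addSn zidx_le_even.
rewrite (sarr_comp u (ltnW (zidx_lt Z t)) p2T).
rewrite (sarr_comp u (ltnW (zidx_lt Z t.+1)) p3T) hcompA.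
have -> : (4 * (d / 2 ^+ t) =
    4 * (d / 2 ^+ t.+2) + (2 * (d / 2 ^+ t) + 2 * (d / 2 ^+ t.+1)))%R.
  by rewrite !exprS; field; rewrite expf_neq0.
apply: rho_le2; first by apply: rho_comprW; exact: IH.
rewrite -!hcompA; apply: rho_complW.
apply: (@rho_le2 _ _ _ _ _ (z t.+2 \c (z t.+1 \c z t))).
  by apply: rho_complW; rewrite rhoC; apply: zarr_turn.
by rewrite hcompA; apply: rho_comprW; apply: zarr_turn.
Qed.

(** Commute z_T back to z_{t+1}, which costs 4 d_{t+1} = 2 d_t, and cancel it
    against z_t, which costs another 2 d_t. *)
Lemma zarr_return s t T (p1T : (p t.+1 <= p T)%N) (pT1 : (p t <= p T.+1)%N) :
  T = (t.+1 + s.*2)%N ->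
  rho (z T \c sarr u p1T \c z t) (sarr u pT1) <= (4 * (d / 2 ^+ t))%:E.
Proof.
move=> eT; have p2T : (p t.+2 <= p T.+1)%N by rewrite eT -addSn zidx_le_even.
rewrite (sarr_comp u (ltnW (zidx_lt Z t)) p2T).
have -> : (4 * (d / 2 ^+ t) = 4 * (d / 2 ^+ t.+1) + 2 * (d / 2 ^+ t))%R.
  by rewrite !exprS; field; rewrite expf_neq0.
apply: (@rho_le2 _ _ _ _ _ (sarr u p2T \c z t.+1 \c z t)).
  by apply: rho_comprW; apply: zarr_commute eT.
by rewrite -hcompA; apply: rho_complW; apply: zarr_turn.
Qed.

Lemma zerr_small (e : R) : (0 < e)%R ->
  exists n0, forall n c, (n0 <= n)%N -> (4 * (d / 2 ^+ (n.*2 + c)) < e)%R.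
Proof.
move=> e0; have de0 : (0 <= 4 * d / e)%R.
  by rewrite divr_ge0// ?mulr_ge0// ltW.
exists (Num.bound (4 * d / e)) => n c bn.
rewrite mulrA ltr_pdivrMr ?exprn_gt0// [ltRHS]mulrC -ltr_pdivrMr//.
apply: lt_le_trans (archi_boundP de0) _.
rewrite -natrX ler_nat; apply: leq_trans bn _.
apply: leq_trans (ltnW (ltn_expl (n.*2 + c) (ltnSn 1))).
by rewrite -addnn -addnA leq_addr.
Qed.

Section Strand.
Variable c : nat.

Lemma strand_idx_homo n m : (n < m)%N ->
  (p (n.*2 + c).+1 < p (m.*2 + c).+1)%N.
Proof.
move=> nm; have -> : ((m.*2 + c).+1 = (n.*2 + c).+3 + (m - n.+1).*2)%N by lia.
exact: leq_trans (zidx_lt Z _) (zidx_le_even _ _).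
Qed.

Lemma strand_near n m (nm : (n <= m)%N)
    (pnm : (p (n.*2 + c).+1 <= p (m.*2 + c).+1)%N) :
  rho (z (m.*2 + c) \c sarr u (zidx_ge c m) \c sarr u nm)
      (sarr u pnm \c (z (n.*2 + c) \c sarr u (zidx_ge c n)))
  <= (4 * (d / 2 ^+ (n.*2 + c)))%:E.
Proof.
have em : (m.*2 + c = (n.*2 + c) + (m - n).*2)%N by lia.
have pm : (p (n.*2 + c) <= p (m.*2 + c))%N by rewrite em zidx_le_even.
rewrite -!hcompA sarr_compE.
rewrite (sarr_irr u _ (leq_trans (zidx_ge c n) pm)) -sarr_compE !hcompA.
by apply: rho_comprW; apply: zarr_commute em.
Qed.

Lemma strand_approx (e : R) : (0 < e)%R ->
  exists n0, forall n m (nm : (n < m)%N), (n0 <= n)%N ->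
    rho (z (m.*2 + c) \c sarr u (zidx_ge c m) \c sarr u (ltnW nm))
        (sarr u (ltnW (strand_idx_homo nm)) \c
           (z (n.*2 + c) \c sarr u (zidx_ge c n))) < e%:E.
Proof.
move=> /zerr_small[n0 small]; exists n0 => n m nm n0n.
by apply: le_lt_trans (strand_near _ _) _; rewrite lte_fin small.
Qed.

(** The links of the parity of c as an approximate arrow.  The n-th one used is
    [2 n + c], because its source index is at least n, which lets u_n be mapped
    there. *)
Definition strand : approxArrow u u :=
  @ApproxArrow _ _ u u (fun n => p (n.*2 + c).+1) strand_idx_homo
    (fun n => z (n.*2 + c) \c sarr u (zidx_ge c n)) strand_approx.

Lemma strand_0arrow : approx_0arrow strand.
Proof.
apply: approx_0arrowP => e e0; have [n0 small] := zerr_small e0.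
exists n0 => n n0n /=.
apply: le_trans (mu_comp_heart _ (sarr_heart _ _)) _.
apply: le_trans (zarr_mu Z _) _; rewrite lee_fin.
apply: le_trans (ltW (small n c n0n)).
by rewrite ler_peMl ?ler1n// divr_ge0 ?exprn_ge0// ltW.
Qed.

End Strand.

(** The composite at n is z_T after z_t, up to bonding arrows, where t and T
    have opposite parities; it remains to see that T > t. *)
Lemma strand_comp_id c c' : (c' = c.+1 \/ c = c'.+1)%N ->
  approx_eq (approx_comp (strand c') (strand c)) (approx_id u).
Proof.
move=> cc'; apply/le_anti/andP; split; last exact: approx_dist_ge0.
apply/lee_addgt0Pr => e e0; rewrite add0e; have [n0 small] := zerr_small e0.
apply: (@approx_dist_le _ _ _ _ _ _ _ n0) => n n0n /=.
set t := (n.*2 + c)%N; set N := p t.+1; set T := (N.*2 + c')%N.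
have eT : T = (t.+1 + (T - t.+1)./2.*2)%N.
  case: cc' => cc'.
    have nN : (n <= N)%N by rewrite /N /t -addnS -cc' zidx_ge.
    by rewrite /T /t cc'; lia.
  have nN : (n < N)%N.
    apply: leq_ltn_trans (zidx_ge c' n) _.
    by rewrite /N /t cc' addnS; exact: zidx_lt.
  by rewrite /T /t cc'; lia.
have tT : (p t <= p T.+1)%N.
  have -> : T.+1 = (t + (T - t.+1)./2.+1.*2)%N by rewrite {1}eT; lia.
  exact: zidx_le_even.
exists (p T.+1), (leqnn _), (leq_trans (zidx_ge c n) tT).
rewrite sarr_id hcomp1f hcompf1 -sarr_compE hcompA.
apply: rho_comprW; apply: le_trans (zarr_return (zidx_ge c' N) tT eT) _.
by rewrite lee_fin ltW// small.
Qed.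

End Theory.
End Zigzag.

(** * The first link and the theorem *)

Section FirstLink.
Local Open Scope ring_scope.
Local Open Scope ereal_scope.
Context {R : realType} (K : normedCategory R) (u : heartSequence K).

(** With px x ~ qx and py y ~ qy, amalgamate qx with l and then qy with the
    arrow that k becomes.  This places u_p and u_q in a common object w' where x
    and y f agree up to r + 4 d, and (A) brings w' back into u. *)
Lemma first_link (a b c : K) (f : arrow a b) (k : arrow b c) (l : arrow a c)
    p q (x : arrow a (u p)) (y : arrow b (u q)) (r d : R) :
  almost_amalgamation K -> fraisse u -> (0 < d)%R ->
  heart k -> heart l -> rho (k \c f) l <= r%:E ->
  mu x < d%:E -> mu y < d%:E ->
  exists m (h : arrow (u p) (u m)) (qm : (q <= m)%N),
    mu h < d%:E /\
    rho (h \c x) (sarr u qm \c (y \c f)) <= (r + 5 * d)%:E.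
Proof.
move=> amalg [_ uA] d0 hk hl kfl /mu_lt[v [px [qx [hpx hqx pqx]]]].
move=> /mu_lt[v' [py [qy [hpy hqy pqy]]]].
have [w [s [s' [hs hs' ss']]]] := amalg _ _ _ _ _ _ hqx hl d0.
have [w' [t [t' [ht ht' tt']]]] :=
  amalg _ _ _ _ _ _ (heart_comp hs' hk) hqy d0.
have [m [qm [g [mug ug]]]] := uA _ _ _ _ d0 (heart_comp ht' hpy).
exists m, (g \c (t \c (s \c px))), (ltnW qm); split.
  apply: le_lt_trans mug; apply: mu_comp_heart.
  by do !apply: heart_comp.
have -> : (r + 5 * d = (d + (d + (r + (d + d)))) + d)%R by ring.
apply: (@rho_le2 _ _ _ _ _ (g \c (t' \c (py \c (y \c f))))); last first.
  rewrite rhoC !hcompA; do 2!apply: rho_comprW.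
  by rewrite -hcompA; apply: ltW.
rewrite -!hcompA; apply: rho_complW.
apply: (@rho_le2 _ _ _ _ _ (t \c (s \c qx))).
  by do 2!apply: rho_complW; apply: ltW.
apply: (@rho_le2 _ _ _ _ _ (t \c (s' \c l))).
  by apply: rho_complW; apply: ltW.
apply: (@rho_le2 _ _ _ _ _ (t \c (s' \c (k \c f)))).
  by do 2!apply: rho_complW; rewrite rhoC.
apply: (@rho_le2 _ _ _ _ _ (t' \c (qy \c f))).
  by rewrite !hcompA; apply: rho_comprW; rewrite -hcompA; apply: ltW.
apply: rho_complW; rewrite hcompA; apply: rho_comprW.
by rewrite rhoC; apply: ltW.
Qed.

Lemma const_aarr_near (a : K) (i : approxArrow (const_seq a) u) (d : R) :
  (0 < d)%R ->
  exists n0, forall n m (nm : (aidx i n <= aidx i m)%N), (n0 <= n)%N ->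
    (n < m)%N -> rho (aarr i m) (sarr u nm \c aarr i n) <= d%:E.
Proof.
move=> /(aarr_approx i)[n0 near]; exists n0 => n m inm n0n nm.
have := near n m nm n0n; rewrite hcompf1 => /ltW.
by rewrite (sarr_irr _ _ inm).
Qed.

End FirstLink.

Theorem theorem3p6 (R : realType) (K : normedCategory R)
  (u : heartSequence K) (hamalg : almost_amalgamation K) (hu : fraisse u)
  (a b : K)
  (i : approxArrow (const_seq a) u) (j : approxArrow (const_seq b) u)
  (hi : approx_0arrow i) (hj : approx_0arrow j)
  (f : arrow a b) (eps : R) (heps : (0 < eps)%R) (hf : (mu f < eps%:E)%E) :
  exists H : approxArrow u u,
    approx_0iso H /\
    (approx_dist (approx_comp j (const_arrow f)) (approx_comp H i)
       < eps%:E)%E.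
Proof.
have [c [k [l [hk hl kfl]]]] := mu_lt hf.
have [r re kflr] : exists2 r : R, (r < eps)%R & (rho (k \c f) l <= r%:E)%E.
  have fin : rho (k \c f) l \is a fin_num.
    by rewrite ge0_fin_numE ?rho_ge0//; apply: lt_trans kfl (ltry _).
  by exists (fine (rho (k \c f) l)); rewrite -?lte_fin fineK.
(* The errors below add up to [r + 11 * d]. *)
pose d : R := ((eps - r) / 12)%R.
have d0 : (0 < d)%R by rewrite divr_gt0// subr_gt0.
have [n1 mui] := approx_0arrow_small hi d0.
have [n2 muj] := approx_0arrow_small hj d0.
have [n3 neari] := const_aarr_near i d0.
have [n4 nearj] := const_aarr_near j d0.
pose n0 := maxn (maxn n1 n2) (maxn n3 n4).
have [n10 n20 n30 n40] : [/\ n1 <= n0, n2 <= n0, n3 <= n0 & n4 <= n0]%N.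
  by rewrite /n0 !leq_max !leqnn !orbT.
have [m [h [jm [muh hx]]]] :=
  first_link hamalg hu d0 hk hl kflr (mui _ n10) (muj _ n20).
(* The first link is used through its effect on i and j only; x stands for
   the arrow [aarr i n0]. *)
pose Q p q (z0 : arrow (u p) (u q)) := exists x : arrow a (u p),
  (forall n, (n0 < n)%N -> exists pn : (p <= aidx i n)%N,
     rho (aarr i n) (sarr u pn \c x) <= d%:E)%E /\
  (forall n, (n0 < n)%N -> exists N (qN : (q <= N)%N) (jN : (aidx j n <= N)%N),
     rho (sarr u jN \c (aarr j n \c f)) (sarr u qN \c (z0 \c x))
       <= (r + 6 * d)%:E)%E.
have [|Z [x [xi xj]]] := zigzag_from (Q := Q) hu d0 muh.
  exists (aarr i n0); split=> n n0n.
    have in0 := ltnW (aidx_homo i n0n).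
    by exists in0; apply: neari.
  have jn0 := ltnW (aidx_homo j n0n).
  pose N := maxn m (aidx j n).
  have mN : (m <= N)%N := leq_maxl _ _.
  have jN : (aidx j n <= N)%N := leq_maxr _ _.
  exists N, mN, jN.
  have -> : (r + 6 * d = d + (r + 5 * d))%R by ring.
  apply: (@rho_le2 _ _ _ _ _ (sarr u jN \c (sarr u jn0 \c aarr j n0 \c f))).
    by do !(apply: rho_complW || apply: rho_comprW); apply: nearj.
  rewrite !hcompA sarr_compE (sarr_irr u _ (leq_trans jm mN)) -sarr_compE.
  by rewrite -!hcompA rhoC; apply: rho_complW.
exists (strand Z d0 0); split.
  split; first exact: strand_0arrow.
  by exists (strand Z d0 1); split; apply: strand_comp_id; [left|right].
apply: (@le_lt_trans _ _ (r + 11 * d)%:E); last first.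
  by rewrite lte_fin /d; lra.
apply: (@approx_dist_le _ _ _ _ _ _ _ n0.+1) => n n0n /=.
have [pn xin] := xi n n0n; have [N [qN [jN xjn]]] := xj n n0n.
set T := ((aidx i n).*2 + 0)%N.
pose M := maxn N (zidx Z T.+1).
have NM : (N <= M)%N := leq_maxl _ _.
have TM : (zidx Z T.+1 <= M)%N := leq_maxr _ _.
exists M, (leq_trans jN NM), TM.
have eT : T = (0 + (aidx i n).*2)%N by rewrite /T addnC.
have pT : (zidx Z 0 <= zidx Z T)%N by rewrite eT zidx_le_even.
have qT : (zidx Z 1 <= zidx Z T.+1)%N by rewrite eT -addSn zidx_le_even.
have -> : (r + 11 * d = (r + 6 * d) + (4 * (d / 2 ^+ 0) + d))%R.
  by rewrite expr0 divr1; ring.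
apply: (@rho_le2 _ _ _ _ _ (sarr u TM \c (sarr u qT \c zarr Z 0 \c x))).
  rewrite !hcompA sarr_compE (sarr_irr u _ (leq_trans qN NM)) -!sarr_compE.
  by rewrite -!hcompA; apply: rho_complW.
apply: rho_complW.
apply: (@rho_le2 _ _ _ _ _ (zarr Z T \c sarr u pT \c x)).
  by apply: rho_comprW; rewrite rhoC; apply: zarr_commute eT.
rewrite (sarr_irr u pT (leq_trans pn (zidx_ge Z 0 (aidx i n)))) -sarr_compE.
rewrite hcompA -(hcompA _ _ x); apply: rho_complW.
by rewrite rhoC.
Qed.
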